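(* Let $m,n\in\mathbb{N}$ with $m,n\geq 3$. The following statements are equivalent: (i) There is an affinely regular $m$-gon in $\mathcal{O}_n$. (ii) $\mathbb{k}_m\subset\mathbb{k}_n$. (iii) $m\in\{3,4,6\}$, or $\mathbb{K}_m\subset\mathbb{K}_n$. (iv) $m\in\{3,4,6\}$, or $m\mid n$, or $m=2d$ with $d$ an odd divisor of $n$. (v) $m\in\{3,4,6\}$, or $\mathcal{O}_m\subset\mathcal{O}_n$. (vi) $o_m\subset o_n$.
   Context: Identify $\mathbb{C}$ with $\mathbb{R}^2$. For $n\in\mathbb{N}$ let $\zeta_n=e^{2\pi i/n}$, $\mathbb{K}_n=\mathbb{Q}(\zeta_n)$, $\mathbb{k}_n=\mathbb{Q}(\zeta_n+\bar\zeta_n)$, $\mathcal{O}_n=\mathbb{Z}[\zeta_n]$ and $o_n=\mathbb{Z}[\zeta_n+\bar\zeta_n]$. The symbol $\subset$ includes equality. A regular polygon is always planar, non-degenerate and convex. An affinely regular polygon is the image of a regular polygon under a non-singular affine transformation $\mathbb{R}^2\to\mathbb{R}^2$, $z\mapsto Az+t$ with $\det A\neq0$. A polygon in a set $S\subset\mathbb{R}^2$ is a convex polygon all of whose vertices lie in $S$. *)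

(* Defs.v *)
(* The complex plane is R[i], identified with R^2 by real and imaginary parts. *)
From HB Require Import structures.
From mathcomp Require Import all_boot all_order all_algebra.
From mathcomp Require Import complex.
From mathcomp Require Import classical_sets reals trigo.

Set Implicit Arguments.
Unset Strict Implicit.
Unset Printing Implicit Defensive.

Import Order.TTheory GRing.Theory Num.Theory.
Local Open Scope ring_scope.
Local Open Scope complex_scope.
Local Open Scope classical_set_scope.

Section Fields.
Variable R : realType.

(* e^(2 pi i / n), through Euler's formula. *)
Definition zeta (n : nat) : R[i] :=
  cos (2%:R * pi / n%:R) +i* sin (2%:R * pi / n%:R).

(* Z[z] and Q(z) inside the complex numbers. A divring-closed subset of a
   field is a subfield, and it contains Q since the characteristic is 0. *)
Definition adjoinZ (z : R[i]) : set R[i] :=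
  smallest [set S : set R[i] | GRing.subring_closed (mem S)] [set z].

Definition adjoinQ (z : R[i]) : set R[i] :=
  smallest [set S : set R[i] | GRing.divring_closed (mem S)] [set z].

Definition Kfield (n : nat) : set R[i] := adjoinQ (zeta n).
Definition kfield (n : nat) : set R[i] := adjoinQ (zeta n + (zeta n)^*).
Definition Oring (n : nat) : set R[i] := adjoinZ (zeta n).
Definition oring (n : nat) : set R[i] := adjoinZ (zeta n + (zeta n)^*).

End Fields.

Arguments Kfield R n _ : clear implicits.
Arguments kfield R n _ : clear implicits.
Arguments Oring R n _ : clear implicits.
Arguments oring R n _ : clear implicits.

(* The real-valued parts, not the (complex-valued) ones of numClosedFieldType. *)
Local Notation Re := complex.Re.
Local Notation Im := complex.Im.

Section Polygons.
Variable R : realType.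
Implicit Types (m : nat) (x y z t : R[i]) (A : 'M[R]_2).

Definition dotc x y : R := Re x * Re y + Im x * Im y.

Definition distc x y : R := Num.sqrt (dotc (y - x) (y - x)).

(* Twice the signed area of the triangle x y z. *)
Definition orient x y z : R :=
  Re (y - x) * Im (z - x) - Im (y - x) * Re (z - x).

(* The unoriented angle, in [0, pi], between the rays from y through x and
   through z. *)
Definition angle x y z : R :=
  acos (dotc (x - y) (z - y) / (distc y x * distc y z)).

(* An m-gon is given by its vertices, listed cyclically (ordS and ord_pred are
   successor and predecessor modulo m, in either direction of traversal). It is
   non-degenerate and convex when the line through any two consecutive vertices
   leaves all the other vertices strictly on one and the same side. *)
Definition convex_polygon m (v : 'I_m -> R[i]) : Prop :=
  (3 <= m)%N /\
  forall i j k : 'I_m,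
    j \notin [:: i; ordS i] -> k \notin [:: i; ordS i] ->
    0 < orient (v i) (v (ordS i)) (v j) * orient (v i) (v (ordS i)) (v k).

(* Equilateral and equiangular; since the polygon is convex, the unoriented
   angle at a vertex is the interior angle. *)
Definition regular_polygon m (v : 'I_m -> R[i]) : Prop :=
  [/\ convex_polygon v,
      forall i j, distc (v i) (v (ordS i)) = distc (v j) (v (ordS j))
    & forall i j, angle (v (ord_pred i)) (v i) (v (ordS i))
                = angle (v (ord_pred j)) (v j) (v (ordS j))].

Definition toR2 z : 'cV[R]_2 :=
  \col_(i < 2) if i == ord0 then Re z else Im z.

Definition affine_map A t z : R[i] :=
  let w := A *m toR2 z in (w ord0 ord0 +i* w ord_max ord0) + t.

Definition affinely_regular_polygon m (v : 'I_m -> R[i]) : Prop :=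
  exists (A : 'M[R]_2) (t : R[i]) (w : 'I_m -> R[i]),
    [/\ \det A != 0, regular_polygon w & forall i, v i = affine_map A t (w i)].

Definition polygon_in m (S : set R[i]) (v : 'I_m -> R[i]) : Prop :=
  convex_polygon v /\ forall i, S (v i).

End Polygons.

(* Main.v *)
Require Import Defs.
From HB Require Import structures.
From mathcomp Require Import all_boot all_order all_algebra.
From mathcomp Require Import algC cyclotomic.
From mathcomp Require Import complex.
From mathcomp Require Import classical_sets reals trigo.
From mathcomp Require Import zify ring lra.

(** Write [zeta_j] for [e^(2 pi i / j)] and [t_j = zeta_j + zeta_j^*], the
    generator of the real field [k_j] and of the real ring [o_j]. Everything
    turns on one question: does the trace [t_m] lie in [K_n]?

    A regular m-gon [w] with consecutive edges [e_i = w_(i+1) - w_i] satisfies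
    [e_(i+1) = omega e_i] for one primitive m-th root of unity [omega]
    ([regular_edge_root]): equal edges and angles fix the inner product of
    consecutive edges and, up to a sign that convexity makes constant, their
    cross product. Hence
      [w_(i+3) - w_i = (1 + omega + omega^-1) (w_(i+2) - w_(i+1))],
    a relation with a real coefficient, which every affine map preserves. If
    the affine image has vertices in [O_n], the coefficient is a quotient of
    elements of [K_n]; and [t_m] is a polynomial in [omega + omega^-1]
    ([trace_of_polygon]).

    Conversely, all powers of [zeta_m] are of the form [a + b zeta_m] with [a]
    and [b] in [o_m]. When [t_m] lies in [o_n], the real-linear map that fixes
    1 and sends [zeta_m] to [zeta_n] thus carries the polygon of the m-th roots
    of unity into [O_n] ([polygon_of_oring]).

    Since [zeta_n] is quadratic over [k_n] and not real, the real elements of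
    [K_n] are those of [k_n], and likewise [O_n] meets the reals in [o_n]
    ([adjoinQ_real_sub], [adjoinZ_real_sub]). So [t_m] may be tested in the
    large or the small ring at will.

    The arithmetic condition comes from Galois theory ([trace_in_Kfield]): if
    [t_m] lies in [K_n] and [a] is a unit modulo [mn] with [a = 1] modulo [n],
    the conjugation [zeta_(mn) -> zeta_(mn)^a] fixes [K_n], so it fixes [t_m],
    which means [a = 1] or [a = -1] modulo [m]. The automorphism is replaced
    by the fact that an integer polynomial vanishing at one primitive root
    vanishes at all of them, which is the irreducibility of the cyclotomic
    polynomials. That units equal to one modulo [n] are so few forces [m] to be
    3, 4 or 6, or to divide [n], or to be twice an odd divisor of [n]
    ([pm1_kernel_cases]). In the last two cases [zeta_m] is, up to sign, a
    power of [zeta_n], and for [m = 3, 4, 6] the trace is [-1], [0] or [1]. *)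

Set Implicit Arguments.
Unset Strict Implicit.
Unset Printing Implicit Defensive.

Import Order.TTheory GRing.Theory Num.Theory.

Local Notation Re := complex.Re.
Local Notation Im := complex.Im.

Local Open Scope classical_set_scope.

(** * Conjugates of a primitive root of unity *)

Section CyclotomicConjugates.
Local Open Scope ring_scope.

(** Irreducibility of the cyclotomic polynomial over the rationals, in the form
    in which it is used. It is the minimal polynomial of a primitive root among
    the algebraic complex numbers, so it divides one factor of any
    factorization, in particular of the one given by the gcd. *)
Lemma Cyclotomic_dvdp_or_coprime n (p : {poly rat}) :
  (0 < n)%N -> (map_poly intr 'Phi_n %| p) || coprimep p (map_poly intr 'Phi_n).
Proof.
move=> n_gt0; have [z prim_z] := C_prim_root_exists n_gt0.
set Phi := map_poly _ _.
have [q [minz _] rootE] := minCpolyP z.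
have dvdPhi r : (Phi %| r) = root (map_poly ratr r) z.
  rewrite rootE; congr (_ %| _); apply: (map_poly_inj (@ratr algC)).
  rewrite -minz (minCpoly_cyclotomic prim_z) -(Cintr_Cyclotomic prim_z).
  by rewrite -map_poly_comp; apply: eq_map_poly => x /=; rewrite ratr_int.
have Phi_neq0 : Phi != 0.
  by apply: monic_neq0; apply: monic_map (Cyclotomic_monic n).
set g := gcdp p Phi.
have /dvdpP [h Dh] : g %| Phi by apply: dvdp_gcdr.
have : root (map_poly ratr Phi) z by rewrite -dvdPhi.
rewrite {1}Dh rmorphM rootM /= -!dvdPhi => /orP [Phi_h|Phi_g]; apply/orP.
  right; rewrite /coprimep -/g.
  have h_neq0 : h != 0 by apply: contraNneq Phi_neq0 => h0; rewrite Dh h0 mul0r.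
  have g_neq0 : g != 0 by apply: contraNneq Phi_neq0 => g0; rewrite Dh g0 mulr0.
  have := dvdp_leq h_neq0 Phi_h.
  rewrite {1}Dh size_mul //.
  move: h_neq0 g_neq0; rewrite -!size_poly_gt0.
  have nat_le (a b : nat) :
    (0 < a)%N -> (0 < b)%N -> ((a + b).-1 <= a)%N -> b == 1%N by lia.
  exact: nat_le.
by left; apply: dvdp_trans Phi_g (dvdp_gcdl _ _).
Qed.

(** By the factorization of [X^k - 1], a power [w^k] is one exactly when the
    cyclotomic polynomial of some divisor of k vanishes at w; comparing k = n
    with k = d shows that the one vanishing at w has index n. *)
Lemma root_Cyclotomic (F : numFieldType) n (w : F) :
  n.-primitive_root w -> root (map_poly intr 'Phi_n) w.
Proof.
move=> prim_w; have n_gt0 := prim_order_gt0 prim_w.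
have unityE k : (0 < k)%N ->
    (w ^+ k == 1) = has (fun d => root (map_poly intr 'Phi_d) w) (divisors k).
  move=> k_gt0.
  have <- : root (map_poly intr ('X^k - 1 : {poly int})) w = (w ^+ k == 1).
    by rewrite /root rmorphB rmorph1 /= map_polyXn !hornerE subr_eq0.
  rewrite -prod_Cyclotomic // rmorph_prod /=.
  elim: (divisors k) => [|d s IHs]; first by rewrite big_nil (negbTE (root1 _)).
  by rewrite big_cons rootM IHs.
have : w ^+ n == 1 by rewrite prim_expr_order.
rewrite unityE // => /hasP [d]; rewrite -dvdn_divisors // => d_n root_d.
have d_gt0 := dvdn_gt0 n_gt0 d_n.
suff -> : n = d by [].
apply/eqP; rewrite eqn_dvd d_n andbT (prim_order_dvd prim_w) unityE //.
by apply/hasP; exists d; rewrite // -dvdn_divisors.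
Qed.

(** Substitute for the Galois group: integer relations are carried from one
    primitive root to another without any automorphism being constructed. *)
Lemma root_int_poly_conj (F : numFieldType) n (w w' : F) (p : {poly int}) :
  n.-primitive_root w -> n.-primitive_root w' ->
  root (map_poly intr p) w -> root (map_poly intr p) w'.
Proof.
move=> prim_w prim_w' pw0; have n_gt0 := prim_order_gt0 prim_w.
have ratrI (q : {poly int}) :
    map_poly (ratr : rat -> F) (map_poly intr q) = map_poly intr q.
  by rewrite -map_poly_comp; apply: eq_map_poly => x /=; rewrite ratr_int.
case/orP: (Cyclotomic_dvdp_or_coprime (map_poly intr p) n_gt0).
  rewrite -(dvdp_map (@ratr F)) !ratrI => /dvdpP [q ->].
  by rewrite rootM root_Cyclotomic ?orbT.
rewrite -(coprimep_map (@ratr F)) !ratrI => /coprimep_root/(_ pw0) /negP[].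
exact: root_Cyclotomic.
Qed.

End CyclotomicConjugates.

(** * Units modulo m that are one modulo n *)

(** Chinese remaindering for moduli that are not coprime, with a solution that
    remains a unit: Bezout writes [gcd m n] as a multiple of [n] modulo [m]. *)
Lemma unit_mod_gcd_lift m n b : (0 < n)%N -> (0 < b)%N -> coprime b m ->
  b = 1 %[mod gcdn m n] ->
  exists a, [/\ coprime a m, coprime a n, a = 1 %[mod n] & a = b %[mod m]].
Proof.
move=> n_gt0 b_gt0 cop_bm /eqP; rewrite eqn_mod_dvd // => /dvdnP [t Dt].
have [u v Duv _] := egcdnP m n_gt0.
have Da : (1 + n * u * t = b + m * v * t)%N by rewrite gcdnC in Duv *; nia.
exists (1 + n * u * t)%N; split.
- by rewrite Da /coprime -[X in gcdn X m]addnC -mulnA gcdnC mulnC gcdnMDl gcdnC.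
- by rewrite -mulnA /coprime addnC mulnC gcdnC gcdnMDl gcdn1.
- by rewrite -mulnA addnC mulnC modnMDl.
- by rewrite Da -mulnA addnC mulnC modnMDl.
Qed.

(** The condition says that the unit group modulo m is {1, -1}. The candidates
    2, m/2 + 1 and m/2 + 2 (for m odd, divisible by 4, and even but not
    divisible by 4) are units, and each bounds m. *)
Lemma pm1_units_cases m : (2 < m)%N ->
  (forall b, (0 < b)%N -> coprime b m -> (m %| b.-1)%N || (m %| b.+1)%N) ->
  m \in [:: 3; 4; 6].
Proof.
move=> m_gt2 pm1; have [m_odd|m_even] := boolP (odd m).
  have := pm1 2 isT; rewrite coprime2n m_odd => /(_ isT).
  by case/orP=> /dvdn_leq; rewrite !inE; lia.
have [k Dk] : exists k, m = (2 * k)%N by exists m./2; lia.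
have copm b : coprime b m = odd b && coprime b k by rewrite Dk coprimeMr coprimen2.
have [k_odd|k_even] := boolP (odd k).
  have := pm1 k.+2 isT; rewrite copm /= k_odd /coprime -addn2 gcdnC gcdnDl.
  rewrite -/(coprime k 2) coprimen2 k_odd => /(_ isT).
  by case/orP=> /dvdn_leq; rewrite !inE; lia.
have := pm1 k.+1 isT; rewrite copm /= k_even coprimeSn => /(_ isT).
by case/orP=> /dvdn_leq; rewrite !inE; lia.
Qed.

(** Put [g = gcd m n] and [q = m / g]. By lifting, the units modulo m that are one
    modulo g are among 1 and -1. If [g <= 2] this is every unit. Otherwise -1 is
    excluded, since it is not one modulo g, so the kernel of reduction from m to
    g is trivial; a common prime factor p of q and g would put 1 + m/p in
    it, so q is coprime to g, and the unit that is -1 modulo q and 1 modulo g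
    shows that q divides 2. *)
Lemma pm1_kernel_cases m n : (2 < m)%N -> (0 < n)%N ->
  (forall a, (0 < a)%N -> coprime a m -> coprime a n -> a = 1 %[mod n] ->
     (m %| a.-1)%N || (m %| a.+1)%N) ->
  m \in [:: 3; 4; 6] \/ (m %| n)%N \/
    exists d : nat, [/\ odd d, (d %| n)%N & m = (2 * d)%N].
Proof.
move=> m_gt2 n_gt0 pm1; have m_gt0 : (0 < m)%N by lia.
pose g := gcdn m n.
have g_gt0 : (0 < g)%N by rewrite gcdn_gt0 m_gt0.
have pm1g b : (0 < b)%N -> coprime b m -> b = 1 %[mod g] ->
    (m %| b.-1)%N || (m %| b.+1)%N.
  move=> b_gt0 cbm b1g.
  have [a [cam can a1 ab]] := unit_mod_gcd_lift n_gt0 b_gt0 cbm b1g.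
  have a_gt0 : (0 < a)%N.
    by case: a cam {can a1 ab} => //; rewrite /coprime gcd0n; lia.
  case/orP: (pm1 a a_gt0 cam can a1) => [m_a|m_a]; apply/orP; [left|right].
    rewrite -subn1 -eqn_mod_dvd // -ab eqn_mod_dvd // subn1 //.
  by rewrite /dvdn -addn1 -modnDml -ab modnDml addn1.
have [q Dm] : exists q, m = (q * g)%N by apply/dvdnP/dvdn_gcdl.
have gn : (g %| n)%N by apply: dvdn_gcdr.
have [g_le2|g_gt2] := leqP g 2.
  left; apply: pm1_units_cases => // b b_gt0 cbm; apply: pm1g => //.
  have : coprime b g by apply: coprime_dvdr cbm; apply: dvdn_gcdl.
  clear -g_le2 g_gt0; case: g g_le2 g_gt0 => [|[|[|]]] // _ _; first by rewrite !modn1.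
  by rewrite coprimen2 !modn2 => ->.
right.
have pm1g' b : (0 < b)%N -> coprime b m -> b = 1 %[mod g] -> (m %| b.-1)%N.
  move=> b_gt0 cbm b1g; case/orP: (pm1g b b_gt0 cbm b1g) => // m_b.
  have : (g %| b.+1)%N by rewrite (dvdn_trans _ m_b) // Dm dvdn_mull.
  by rewrite /dvdn -addn1 -modnDml b1g modnDml /= modn_small.
have cop_qg : coprime q g.
  apply/negPn/negP; rewrite /coprime => q_g.
  have gcd_gt0 : (0 < gcdn q g)%N by rewrite gcdn_gt0 g_gt0 orbT.
  pose p := pdiv (gcdn q g).
  have p_pr : prime p by apply: pdiv_prime; lia.
  have /dvdnP [q' Dq] : (p %| q)%N := dvdn_trans (pdiv_dvd _) (dvdn_gcdl _ _).
  have /dvdnP [g' Dg] : (p %| g)%N := dvdn_trans (pdiv_dvd _) (dvdn_gcdr _ _).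
  have p_gt1 := prime_gt1 p_pr.
  have := pm1g' (q' * g).+1 isT.
  rewrite [X in coprime _ X]Dm Dq [X in (_ * _ * X)%N]Dg => /(_ _ _)/dvdn_leq.
  have cop1 : coprime (q' * g).+1 (q' * g) by rewrite coprimeSn.
  have cq : coprime (q' * g).+1 q' by rewrite (coprime_dvdr _ cop1) ?dvdn_mulr.
  have cg : coprime (q' * g).+1 g by rewrite (coprime_dvdr _ cop1) ?dvdn_mull.
  have cp : coprime (q' * g).+1 p.
    by rewrite (coprime_dvdr _ cg) // Dg dvdn_mull.
  rewrite -Dg !coprimeMr cq cp cg => H.
  have H2 : (q' * g).+1 = 1 %[mod g] by rewrite -addn1 modnMDl.
  have q'g_gt0 : (0 < q' * g)%N.
    by rewrite muln_gt0 g_gt0 andbT; case: (q') Dq Dm => // ->; lia.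
  have := H q'g_gt0 isT H2; rewrite Dm Dq mulnAC /=.
  by rewrite -[X in (_ <= X)%N]muln1 leq_pmul2l // leqNgt p_gt1.
have q_gt0 : (0 < q)%N by lia.
have [b [bq bg]] : exists b, b = q.-1 %[mod q] /\ b = 1 %[mod g].
  by exists (chinese q g q.-1 1); rewrite chinese_modl // chinese_modr.
have cbq : coprime b q by rewrite -coprime_modl bq coprime_modl coprimePn.
have cbg : coprime b g by rewrite -coprime_modl bg coprime_modl coprime1n.
have b_gt0 : (0 < b)%N.
  by case: b bg {bq cbq cbg} => //; rewrite mod0n modn_small //; lia.
have m_b : (m %| b.-1)%N by apply: pm1g' => //; rewrite Dm coprimeMr cbq.
have q_b : (q %| b.-1)%N by rewrite (dvdn_trans _ m_b) // Dm dvdn_mulr.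
have q_2 : (q %| 2)%N.
  have q_b1 : (q %| b.+1)%N.
    by rewrite /dvdn -addn1 -modnDml bq modnDml addn1 prednK // modnn.
  by rewrite -(dvdn_addr _ q_b); rewrite addn2 prednK.
have := dvdn_leq (isT : 0 < 2)%N q_2;
case: q Dm q_gt0 cop_qg {bq cbq q_b q_2 bg cbg b_gt0 m_b} => [|[|[|]]] //.
all: move=> Dm _ cop _.
  by left; rewrite Dm mul1n.
by right; exists g; rewrite -coprime2n.
Qed.

(** * The root of unity zeta *)

Section Zeta.
Local Open Scope complex_scope.
Local Open Scope ring_scope.

Lemma primitive_root_neq0 (F : fieldType) n (z : F) : n.-primitive_root z -> z != 0.
Proof.
move=> prim_z; have := prim_expr_order prim_z; apply: contra_eq_neq => ->.
by rewrite expr0n gtn_eqF ?(prim_order_gt0 prim_z) // eq_sym oner_eq0.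
Qed.

Variable R : realType.
Implicit Types (x y : R) (m n k : nat).

Definition cis x : R[i] := cos x +i* sin x.

Lemma cisD x y : cis (x + y) = cis x * cis y.
Proof. by rewrite /cis cosD sinD; simpc; congr (_ +i* _); ring. Qed.

Lemma cis0 : cis 0 = 1.
Proof. by rewrite /cis cos0 sin0. Qed.

Lemma cisMn x k : cis (x *+ k) = cis x ^+ k.
Proof. by elim: k => [|k IHk]; rewrite ?cis0 // mulrS cisD IHk exprS. Qed.

Lemma zetaX n k : zeta R n ^+ k = cis (2 * pi / n%:R *+ k).
Proof. by rewrite cisMn. Qed.

Lemma zeta_root n k : (0 < k)%N -> zeta R (k * n) ^+ k = zeta R n.
Proof.
move=> k_gt0; rewrite zetaX /zeta -/(cis _); congr cis.
have k_neq0 : k%:R != 0 :> R by rewrite pnatr_eq0 -lt0n.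
by rewrite natrM invfM -[LHS]mulr_natr [k%:R^-1 * _]mulrC mulrA divfK.
Qed.

(** An order [d < n] would give [cos (2t) = 1] with [t = pi d / n] in the open
    interval from 0 to pi, where the sine is positive. *)
Lemma zeta_prim n : (0 < n)%N -> n.-primitive_root (zeta R n).
Proof.
move=> n_gt0; have nn0 : n%:R != 0 :> R by rewrite pnatr_eq0 -lt0n.
have zn1 : zeta R n ^+ n = 1.
  rewrite zetaX -[_ *+ n]mulr_natr divfK // mulrC mulr_natr.
  by rewrite /cis cos2pi sin2pi.
have [d prim_d d_n] := prim_order_exists n_gt0 zn1.
suff Dn : n = d by rewrite [X in X.-primitive_root _]Dn.
have d_gt0 := prim_order_gt0 prim_d.
apply/eqP; rewrite eqn_leq [(d <= n)%N]dvdn_leq // andbT leqNgt; apply/negP => lt_dn.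
have := prim_expr_order prim_d; rewrite zetaX => -[cosd _].
pose t : R := pi * d%:R / n%:R.
have tE : 2 * pi / n%:R *+ d = t *+ 2 by rewrite -[LHS]mulr_natr -[RHS]mulr_natr /t; field.
have : 0 < sin t.
  apply: sin_gt0_pi; rewrite /t divr_gt0 ?mulr_gt0 ?pi_gt0 ?ltr0n //=.
  by rewrite ltr_pdivrMr ?ltr0n // ltr_pM2l ?pi_gt0 // ltr_nat.
move: cosd; rewrite tE cos_mulr2n cos2sin2 => cosd.
have : sin t ^+ 2 = 0 by lra.
by move/eqP; rewrite sqrf_eq0 => /eqP ->; rewrite ltxx.
Qed.

Lemma zetaJ n : zeta R n * (zeta R n)^*%C = 1.
Proof.
rewrite /zeta; simpc; congr (_ +i* _); last by rewrite mulrC addNr.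
by rewrite -!expr2 cos2Dsin2.
Qed.

Lemma Im_zeta_gt0 n : (3 <= n)%N -> 0 < Im (zeta R n).
Proof.
move=> n_ge3; apply: sin_gt0_pi; have n_gt0 : 0 < n%:R :> R by rewrite ltr0n; lia.
apply/andP; split; first by rewrite divr_gt0 // mulr_gt0 // pi_gt0.
rewrite ltr_pdivrMr //.
by rewrite mulrC ltr_pM2l ?pi_gt0 // ltr_nat.
Qed.

Lemma Im_zeta_neq0 n : (3 <= n)%N -> Im (zeta R n) != 0.
Proof. by move=> n_ge3; rewrite gt_eqF ?Im_zeta_gt0. Qed.

Lemma unitJ_inv (z : R[i]) : z * z^*%C = 1 -> z^*%C = z^-1.
Proof.
move=> zz; have z0 : z != 0.
  by apply: contra_eq_neq zz => ->; rewrite mul0r eq_sym oner_eq0.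
by apply: (mulfI z0); rewrite zz divff.
Qed.

End Zeta.

(** * Subrings and subfields generated by a complex number *)

Section Adjunction.
Local Open Scope complex_scope.
Local Open Scope ring_scope.
Variable R : realType.
Implicit Types (S E : set R[i]) (x y z : R[i]).

Lemma subring_closedP S : GRing.subring_closed (mem S) <->
  [/\ S 1, forall x y, S x -> S y -> S (x - y) & forall x y, S x -> S y -> S (x * y)].
Proof.
split=> -[S1 SB SM]; split.
- exact: set_mem S1.
- by move=> x y Sx Sy; apply/set_mem/SB; apply/mem_set.
- by move=> x y Sx Sy; apply/set_mem/SM; apply/mem_set.
- exact: mem_set.
- by move=> x y /set_mem Sx /set_mem Sy; apply/mem_set/SB.
- by move=> x y /set_mem Sx /set_mem Sy; apply/mem_set/SM.
Qed.

Lemma divring_closedP S : GRing.divring_closed (mem S) <->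
  GRing.subring_closed (mem S) /\ forall x, S x -> S x^-1.
Proof.
split=> [Sdiv|[/subring_closedP[S1 SB SM] SV]].
  split; first exact: GRing.divring_closedBM Sdiv.
  case: Sdiv => S1 _ SV x Sx; apply/set_mem; rewrite -div1r; apply: SV => //.
  exact/mem_set.
split; first exact: mem_set.
- by move=> x y /set_mem Sx /set_mem Sy; apply/mem_set/SB.
- by move=> x y /set_mem Sx /set_mem Sy; apply/mem_set/SM => //; apply: SV.
Qed.

Lemma adjoinZ_subring z : GRing.subring_closed (mem (adjoinZ z)).
Proof.
apply/subring_closedP; split=> [|x y xS yS|x y xS yS] S SP.
- by case: SP => /subring_closedP[].
- have [Sx Sy] := (xS S SP, yS S SP).
  by case: SP => /subring_closedP[_ SB _] _; apply: SB.
- have [Sx Sy] := (xS S SP, yS S SP).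
  by case: SP => /subring_closedP[_ _ SM] _; apply: SM.
Qed.

Lemma adjoinQ_divring z : GRing.divring_closed (mem (adjoinQ z)).
Proof.
apply/divring_closedP; split.
  apply/subring_closedP; split=> [|x y xS yS|x y xS yS] S SP.
  - by case: SP => /divring_closedP[/subring_closedP[]].
  - have [Sx Sy] := (xS S SP, yS S SP).
    by case: SP => /divring_closedP[/subring_closedP[_ SB _] _] _; apply: SB.
  - have [Sx Sy] := (xS S SP, yS S SP).
    by case: SP => /divring_closedP[/subring_closedP[_ _ SM] _] _; apply: SM.
move=> x xS S SP; have Sx := xS S SP.
by case: SP => /divring_closedP[_ SV] _; apply: SV.
Qed.

Lemma adjoinZ_gen z : adjoinZ z z. Proof. exact: sub_gen_smallest. Qed.
Lemma adjoinQ_gen z : adjoinQ z z. Proof. exact: sub_gen_smallest. Qed.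

Lemma adjoinZ_min z S : GRing.subring_closed (mem S) -> S z -> adjoinZ z `<=` S.
Proof. by move=> ? Sz; apply: smallest_sub => // _ ->. Qed.

Lemma adjoinQ_min z S : GRing.divring_closed (mem S) -> S z -> adjoinQ z `<=` S.
Proof. by move=> ? Sz; apply: smallest_sub => // _ ->. Qed.

Lemma adjoinZ_sub_adjoinQ z : adjoinZ z `<=` adjoinQ z.
Proof.
apply: (adjoinZ_min _ (@adjoinQ_gen _)).
by case/divring_closedP: (adjoinQ_divring z).
Qed.

Section Subring.
Variables (S : set R[i]) (Sring : GRing.subring_closed (mem S)).

Lemma subring1 : S 1. Proof. by case/subring_closedP: Sring. Qed.
Lemma subringB x y : S x -> S y -> S (x - y).
Proof. by case/subring_closedP: Sring => _ SB _; apply: SB. Qed.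
Lemma subringM x y : S x -> S y -> S (x * y).
Proof. by case/subring_closedP: Sring => _ _; apply. Qed.
Lemma subring0 : S 0.
Proof. by rewrite -(subrr 1); apply: subringB subring1 subring1. Qed.
Lemma subringN x : S x -> S (- x).
Proof. by rewrite -sub0r; apply: subringB subring0. Qed.
Lemma subringD x y : S x -> S y -> S (x + y).
Proof. by move=> Sx Sy; rewrite -[y]opprK; apply/subringB/subringN. Qed.
Lemma subringX x k : S x -> S (x ^+ k).
Proof.
move=> Sx; elim: k => [|k IHk]; first by rewrite expr0; apply: subring1.
by rewrite exprS; apply: subringM.
Qed.

(** The Chebyshev recurrence: [x^k + x^-k] is an integer polynomial in [x + x^-1]. *)
Lemma subring_XDXV x k : x != 0 -> S (x + x^-1) -> S (x ^+ k + x ^- k).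
Proof.
move=> x0 Sx; suff [] : S (x ^+ k + x ^- k) /\ S (x ^+ k.+1 + x ^- k.+1) by [].
elim: k => [|k [IH1 IH2]].
  by rewrite expr0 invr1 expr1; split=> //; apply: subringD subring1 subring1.
split=> //; have -> : x ^+ k.+2 + x ^- k.+2 =
  (x + x^-1) * (x ^+ k.+1 + x ^- k.+1) - (x ^+ k + x ^- k).
  have xk0 : x ^+ k != 0 by rewrite expf_neq0.
  by rewrite !exprS; field; rewrite xk0 x0.
by apply: subringB => //; apply: subringM.
Qed.

End Subring.

Lemma real_divring_closed : GRing.divring_closed (mem [set x : R[i] | Im x = 0]).
Proof.
apply/divring_closedP; split; [apply/subring_closedP; split=> //|].
- by move=> [a b] [c d] /= -> ->; rewrite subr0.
- by move=> [a b] [c d] /= -> ->; rewrite mulr0 mul0r addr0.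
- by move=> [a b] /= ->; rewrite mul0r oppr0.
Qed.

Lemma adjoinQ_real s : Im s = 0 -> adjoinQ s `<=` [set x : R[i] | Im x = 0].
Proof. by move=> s_real; apply: adjoinQ_min real_divring_closed _. Qed.

Lemma traceJ_real z : Im (z + z^*%C) = 0.
Proof. by case: z => a b /=; rewrite subrr. Qed.

(** * The real elements of Z[z] and Q(z) for z on the unit circle *)

Section Quadratic.
Variable z : R[i].
Hypothesis zz : z * z^*%C = 1.

(** For z on the unit circle with trace s, [z^2 = s z - 1]; if E is a ring
    containing the trace of z, this is the ring E[z]. *)
Definition quadratic_span E : set R[i] :=
  [set x | exists a b, [/\ E a, E b & x = a + b * z]].

Lemma quadratic_sqr : z ^+ 2 = (z + z^*%C) * z - 1.
Proof. by rewrite mulrDl [_^*%C * z]mulrC zz addrK. Qed.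

Lemma quadratic_subring E : GRing.subring_closed (mem E) -> E (z + z^*%C) ->
  GRing.subring_closed (mem (quadratic_span E)).
Proof.
move=> Ering Es; apply/subring_closedP; split.
- exists 1, 0; split; [exact: subring1|exact: subring0|by rewrite mul0r addr0].
- move=> _ _ [a [b [Ea Eb ->]]] [c [d [Ec Ed ->]]].
  by exists (a - c), (b - d); split; [exact: subringB| exact: subringB| ring].
move=> _ _ [a [b [Ea Eb ->]]] [c [d [Ec Ed ->]]].
exists (a * c - b * d), (a * d + b * c + b * d * (z + z^*%C)); split.
- by apply: subringB => //; apply: subringM.
- by do ![apply: subringD => // | apply: subringM => //].
have -> : (a + b * z) * (c + d * z) =
  a * c + (a * d + b * c) * z + b * d * z ^+ 2 by ring.
by rewrite quadratic_sqr; ring.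
Qed.

Lemma real_conj x : Im x = 0 -> x^*%C = x.
Proof. by case: x => a b /= ->; rewrite oppr0. Qed.

(** Complex conjugation fixes E and sends z to its trace minus z, so the
    inverse of x is its conjugate divided by a norm that lies in E. *)
Lemma quadratic_divring E : GRing.divring_closed (mem E) -> E (z + z^*%C) ->
  E `<=` [set x : R[i] | Im x = 0] -> GRing.divring_closed (mem (quadratic_span E)).
Proof.
case/divring_closedP=> Ering EV Es E_real.
apply/divring_closedP; split; first exact: quadratic_subring.
move=> _ [a [b [Ea Eb ->]]]; set x := a + b * z; set s := z + z^*%C in Es.
have [x0|x0] := eqVneq x 0.
  exists 0, 0; rewrite x0 invr0 mul0r addr0; split=> //; exact: subring0.
have xJ : x^*%C = a + b * s - b * z.
  rewrite /x /s rmorphD rmorphM /=.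
  by rewrite (real_conj (E_real _ Ea)) (real_conj (E_real _ Eb)); ring.
pose N := a ^+ 2 + a * b * s + b ^+ 2.
have NE : N = x * x^*%C.
  rewrite xJ; have -> : x * (a + b * s - b * z) =
    a ^+ 2 + a * b * s - b ^+ 2 * (z ^+ 2 - s * z) by rewrite /x; ring.
  by rewrite quadratic_sqr -/s /N; ring.
have EN : E N.
  by do ![apply: subringD => // | apply: subringM => // | apply: subringX].
have xJ0 : x^*%C != 0 by rewrite conjc_eq0.
exists ((a + b * s) / N), (- b / N); split.
- by apply: subringM => //; [apply: subringD => //; apply: subringM|apply: EV].
- by apply: subringM => //; [apply: subringN|apply: EV].
have -> : x^-1 = x^*%C / N by rewrite NE invfM mulrCA mulfV ?mulr1.
by rewrite xJ; ring.
Qed.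

(** When z is not real, 1 and z are linearly independent over the reals. *)
Lemma quadratic_real E x : E `<=` [set x : R[i] | Im x = 0] -> Im z != 0 ->
  quadratic_span E x -> Im x = 0 -> E x.
Proof.
move=> E_real z_nr [a [b [Ea Eb ->]]]; move: (E_real _ Ea) (E_real _ Eb) => /=.
case: a b z z_nr Ea Eb => [a a'] [b b'] [u v] /= v0 Ea Eb a0 b0.
rewrite a0 b0 mul0r addr0 add0r => /eqP.
rewrite mulf_eq0 (negPf v0) orbF => /eqP b0'.
have -> : (a +i* 0) + (b +i* 0) * (u +i* v) = a +i* 0.
  by rewrite b0'; simpc; rewrite ?mul0r ?subrr ?addr0.
by rewrite -a0.
Qed.

Lemma adjoinZ_real_sub : Im z != 0 ->
  adjoinZ z `&` [set x : R[i] | Im x = 0] `<=` adjoinZ (z + z^*%C).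
Proof.
move=> z_nr x [zx x_real]; have sring := adjoinZ_subring (z + z^*%C).
apply: quadratic_real z_nr _ x_real.
  by move=> y /adjoinZ_sub_adjoinQ; apply: adjoinQ_real; apply: traceJ_real.
apply: adjoinZ_min zx; first by apply: quadratic_subring => //; exact: adjoinZ_gen.
by exists 0, 1; split; [exact: subring0 | exact: subring1 | ring].
Qed.

Lemma adjoinQ_real_sub : Im z != 0 ->
  adjoinQ z `&` [set x : R[i] | Im x = 0] `<=` adjoinQ (z + z^*%C).
Proof.
move=> z_nr x [zx x_real]; have sdivring := adjoinQ_divring (z + z^*%C).
have [sring _] := (divring_closedP _).1 sdivring.
have s_real := adjoinQ_real (traceJ_real z).
apply: quadratic_real z_nr _ x_real => //.
apply: adjoinQ_min zx; first by apply: quadratic_divring => //; exact: adjoinQ_gen.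
by exists 0, 1; split; [exact: subring0 | exact: subring1 | ring].
Qed.

End Quadratic.

(** Fractions of integer polynomials are visibly closed under inversion, whereas
    describing Q(w) by polynomials alone would take a Bezout argument. *)
Lemma adjoinQ_frac (w x : R[i]) : adjoinQ w x ->
  exists f g : {poly int}, (map_poly intr g).[w] != 0 /\
    x = (map_poly intr f).[w] / (map_poly intr g).[w].
Proof.
move: x; apply: (adjoinQ_min (S := [set x | _])) => /=; last first.
  by exists 'X, 1; rewrite map_polyX rmorph1 !hornerE oner_eq0 divr1.
apply/divring_closedP; split; [apply/subring_closedP; split|].
- by exists 1, 1; rewrite rmorph1 !hornerE oner_eq0 ?(divr1, invr1, mulr1).
- move=> _ _ [f [g [g0 ->]]] [h [k [k0 ->]]].
  exists (f * k - h * g), (g * k).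
  rewrite rmorphB !rmorphM /= hornerD hornerN !hornerM mulf_neq0 //; split=> //.
  by field; rewrite g0 k0.
- move=> _ _ [f [g [g0 ->]]] [h [k [k0 ->]]].
  exists (f * h), (g * k).
  rewrite !rmorphM /= !hornerM mulf_neq0 //; split=> //.
  by field; rewrite g0 k0.
move=> _ [f [g [g0 ->]]]; have [f0|f0] := eqVneq (map_poly intr f).[w] 0.
  by exists 0, 1; rewrite rmorph1 rmorph0 f0 !hornerE oner_eq0 ?(mul0r, invr0).
by exists g, f; split=> //; rewrite invf_div.
Qed.

End Adjunction.

(** * Traces of roots of unity *)

Section CyclotomicTraces.
Local Open Scope complex_scope.
Local Open Scope ring_scope.
Variable R : realType.
Implicit Types S : set R[i].

(** With [w = zeta_(mn)], the membership of the trace of [u = zeta_m] in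
    Q([zeta_n]) is an integer polynomial relation in [w]. Substituting the
    conjugate [w^a] leaves [zeta_n] unchanged, so [u^a + u^-a = u + u^-1], that is
    [(u^a - u) (u^a - u^-1) = 0]. *)
Lemma trace_in_Kfield m n a : (0 < m)%N -> (0 < n)%N ->
  Kfield R n (zeta R m + (zeta R m)^*%C) ->
  (0 < a)%N -> coprime a m -> coprime a n -> a = 1 %[mod n] ->
  (m %| a.-1)%N || (m %| a.+1)%N.
Proof.
move=> m_gt0 n_gt0 /adjoinQ_frac [f [g [gn0 Dtrace]]] a_gt0 cam can a1.
set u := zeta R m; set v := zeta R n in gn0 Dtrace.
have prim_u : m.-primitive_root u := zeta_prim R m_gt0.
have prim_v : n.-primitive_root v := zeta_prim R n_gt0.
have um1 : u^-1 = u ^+ m.-1.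
  have u0 : u != 0 by rewrite (primitive_root_neq0 prim_u).
  by apply: (mulfI u0); rewrite divff // -exprS prednK // prim_expr_order.
pose w := zeta R (m * n).
have prim_w : (m * n).-primitive_root w by apply: zeta_prim; rewrite muln_gt0 m_gt0.
have wn : w ^+ n = u by rewrite /w mulnC; apply: zeta_root.
have wm : w ^+ m = v by apply: zeta_root.
(* The relation between the traces with denominators cleared, in terms of w;
   the exponent n * m.-1 stands for the inverse of u = w ^+ n. *)
pose P : {poly int} := ('X^n + 'X^(n * m.-1)) * (g \Po 'X^m) - (f \Po 'X^m).
have PE x : (map_poly intr P).[x] =
    (x ^+ n + x ^+ (n * m.-1)) * (map_poly intr g).[x ^+ m]
    - (map_poly intr f).[x ^+ m] :> R[i].
  rewrite /P rmorphB rmorphM rmorphD /= !map_comp_poly !map_polyXn.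
  by rewrite hornerD hornerN hornerM hornerD !horner_comp !hornerXn.
have rootw : root (map_poly intr P) w.
  rewrite /root PE exprM wn wm -um1 -(unitJ_inv (zetaJ R m)) -/u Dtrace.
  by rewrite divfK // subrr.
have prim_wa : (m * n).-primitive_root (w ^+ a).
  by rewrite prim_root_exp_coprime // coprimeMr cam.
have := root_int_poly_conj prim_w prim_wa rootw.
have va : v ^+ a = v.
  by rewrite -[RHS]expr1; apply/eqP; rewrite (eq_prim_root_expr prim_v) a1.
have wan : (w ^+ a) ^+ n = u ^+ a by rewrite exprAC wn.
have wam : (w ^+ a) ^+ m = v by rewrite exprAC wm va.
rewrite /root PE exprM wan wam [u ^+ a ^+ _]exprAC -um1 subr_eq0 => /eqP.
move/(canRL (mulfK gn0)); rewrite -Dtrace (unitJ_inv (zetaJ R m)) -/u => ua.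
have u0 : u != 0 by rewrite (primitive_root_neq0 prim_u).
have ua0 : u ^+ a != 0 by rewrite expf_neq0.
have : (u ^+ a - u) * (u ^+ a - u^-1) = 0.
  have -> : (u ^+ a - u) * (u ^+ a - u^-1) =
      u ^+ a * (u ^+ a + (u ^+ a)^-1 - (u + u^-1)).
    by field; rewrite u0.
  by rewrite -exprVn ua subrr mulr0.
move/eqP; rewrite mulf_eq0 => /orP[]; rewrite subr_eq0 => /eqP Dua;
  apply/orP; [left|right].
  rewrite (prim_order_dvd prim_u); apply/eqP/(mulfI u0).
  by rewrite -exprS prednK // Dua mulr1.
by rewrite (prim_order_dvd prim_u) exprS Dua divff.
Qed.

(** If [m = 2 d] with [d] odd then [zeta_m^d = -1], so
    [zeta_m = - zeta_m^(d+1) = - zeta_d^((d+1)/2)]. *)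
Lemma zeta_pow_of_dvd m n : (0 < m)%N -> (0 < n)%N ->
  (m %| n)%N \/ (exists d, [/\ odd d, (d %| n)%N & m = (2 * d)%N]) ->
  exists e k, zeta R m = (-1) ^+ e * zeta R n ^+ k.
Proof.
move=> m_gt0 n_gt0.
have dvd_pow d : (d %| n)%N -> exists k, zeta R d = zeta R n ^+ k.
  case/dvdnP=> k Dn; exists k; rewrite Dn zeta_root //.
  by move: n_gt0; rewrite Dn muln_gt0 => /andP[].
case=> [/dvd_pow [k ->]|[d [d_odd /dvd_pow [k Dk] Dm]]].
  by exists 0, k; rewrite mul1r.
have d_gt0 : (0 < d)%N by rewrite odd_gt0.
have z2 : zeta R m ^+ 2 = zeta R d by rewrite Dm zeta_root.
have zd : zeta R m ^+ d = -1.
  have prim_m := zeta_prim R m_gt0.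
  have : (zeta R m ^+ d) ^+ 2 == 1.
    by rewrite -exprM mulnC -Dm prim_expr_order.
  rewrite sqrf_eq1 => /orP[|/eqP //]; rewrite -(prim_order_dvd prim_m) => /dvdn_leq.
  by rewrite Dm; lia.
exists 1, (k * (d.+1)./2)%N; rewrite expr1 exprM -Dk -z2 -exprM mulnC.
have -> : ((d.+1)./2 * 2)%N = d.+1 by lia.
by rewrite exprS zd mulrN1 mulN1r opprK.
Qed.

(** The primitive roots of order 3, 4 and 6 satisfy [z^2 - t z + 1 = 0] with [t]
    equal to -1, 0 and 1 respectively. *)
Lemma trace_346 m S : m \in [:: 3; 4; 6] -> GRing.subring_closed (mem S) ->
  S (zeta R m + (zeta R m)^*%C).
Proof.
move=> m346 Sring; have m_gt0 : (0 < m)%N by move: m346; rewrite !inE; lia.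
have prim_m := zeta_prim R m_gt0.
rewrite (unitJ_inv (zetaJ R m)).
move: (zeta R m) prim_m => z prim_m; have z0 := primitive_root_neq0 prim_m.
have zj1 j : ~~ (m %| j)%N -> z ^+ j - 1 != 0.
  by rewrite (prim_order_dvd prim_m) subr_eq0.
have zm1 : z ^+ m - 1 = 0 by rewrite prim_expr_order // subrr.
have trE (t : R[i]) : z ^+ 2 - t * z + 1 = 0 -> z + z^-1 = t.
  move=> zt; apply: (mulIf z0); rewrite mulrDl mulVf //.
  by apply/eqP; rewrite -subr_eq0 -zt; apply/eqP; ring.
move: m346; rewrite !inE => /or3P[] /eqP Dm; rewrite Dm in zj1 zm1.
- have -> : z + z^-1 = -1.
    apply: trE; apply: (mulfI (zj1 1%N isT)); rewrite [RHS]mulr0 -[RHS]zm1; ring.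
  exact: (subringN Sring (subring1 Sring)).
- have -> : z + z^-1 = 0.
    apply: trE; apply: (mulfI (zj1 2%N isT)); rewrite [RHS]mulr0 -[RHS]zm1; ring.
  exact: subring0.
have -> : z + z^-1 = 1; last exact: subring1.
have z1 : z + 1 != 0.
  by apply: contraNneq (zj1 2%N isT) => z1; rewrite subr_sqr_1 z1 mulr0.
apply: trE; apply: (mulfI (zj1 3%N isT)); apply: (mulfI z1).
by rewrite !mulr0 -[RHS]zm1; ring.
Qed.

Lemma trace_Oring n : (0 < n)%N ->
  Oring R n (zeta R n + (zeta R n)^*%C).
Proof.
move=> n_gt0; have zring := adjoinZ_subring (zeta R n).
apply: (subringD zring); first exact: adjoinZ_gen.
have -> : (zeta R n)^*%C = zeta R n ^+ n.-1.
  rewrite -[LHS]mul1r -(prim_expr_order (zeta_prim R n_gt0)) -{2}(prednK n_gt0).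
  by rewrite exprSr -mulrA zetaJ mulr1.
apply: (subringX zring); exact: adjoinZ_gen.
Qed.

End CyclotomicTraces.

(** * Euclidean and affine geometry of the plane *)

Section Plane.
Local Open Scope complex_scope.
Local Open Scope ring_scope.
Variable R : realType.
Implicit Types x y z t u : R[i].

(** The signed area of the parallelogram on two vectors; [dotc] and this are the
    real and imaginary parts of the product of the second vector with the
    conjugate of the first. *)
Definition crossc x y : R := Re x * Im y - Im x * Re y.

Lemma conjc_mulE x y : x^*%C * y = dotc x y +i* crossc x y.
Proof.
case: x y => [a b] [c d]; rewrite /dotc /crossc /=; simpc.
by congr (_ +i* _); ring.
Qed.

Lemma orientE x y z : orient x y z = crossc (y - x) (z - y).
Proof. by case: x y z => [a b] [c d] [e f]; rewrite /orient /crossc /=; ring. Qed.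

Lemma orient_rot x y z : orient x y z = orient y z x.
Proof. by case: x y z => [a b] [c d] [e f]; rewrite /orient /=; ring. Qed.

Lemma orient_xyx x y : orient x y x = 0.
Proof. by rewrite /orient subrr mulr0 mulr0 subrr. Qed.

Lemma orient_xxy x y : orient x x y = 0.
Proof. by rewrite orient_rot orient_xyx. Qed.

Lemma Lagrange_identity x y : dotc x y ^+ 2 + crossc x y ^+ 2 = dotc x x * dotc y y.
Proof. by case: x y => [a b] [c d]; rewrite /dotc /crossc /=; ring. Qed.

Lemma dotc_ge0 x : 0 <= dotc x x.
Proof. by rewrite /dotc -!expr2 addr_ge0 ?sqr_ge0. Qed.

Lemma dotc_eq0 x : dotc x x = 0 -> x = 0.
Proof.
rewrite /dotc -!expr2 => /eqP; rewrite paddr_eq0 ?sqr_ge0 // !sqrf_eq0.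
by case: x => a b /= /andP [/eqP -> /eqP ->].
Qed.

Lemma dotc_gt0 x : x != 0 -> 0 < dotc x x.
Proof.
by move=> x0; rewrite lt_def dotc_ge0 andbT; apply: contraNneq x0 => /dotc_eq0 ->.
Qed.

Lemma dotcNN x y : dotc (- x) (- y) = dotc x y.
Proof. by case: x y => [a b] [c d]; rewrite /dotc /=; ring. Qed.

Lemma dotcNl x y : dotc (- x) y = - dotc x y.
Proof. by case: x y => [a b] [c d]; rewrite /dotc /=; ring. Qed.

Lemma distc_sqr x y : distc x y ^+ 2 = dotc (y - x) (y - x).
Proof. by rewrite /distc sqr_sqrtr // dotc_ge0. Qed.

Lemma dotcM u x y : dotc (u * x) (u * y) = dotc u u * dotc x y.
Proof. by case: u x y => [p q] [a b] [c d]; rewrite /dotc /=; ring. Qed.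

Lemma orientM u x y z : orient (u * x) (u * y) (u * z) = dotc u u * orient x y z.
Proof. by case: u x y z => [p q] [a b] [c d] [e f]; rewrite /dotc /orient /=; ring. Qed.

Lemma dotc_unit u : u * u^*%C = 1 -> dotc u u = 1.
Proof. by rewrite mulrC conjc_mulE => -[]. Qed.

Lemma distcM u x y : u * u^*%C = 1 -> distc (u * x) (u * y) = distc x y.
Proof. by move=> uu; rewrite /distc -mulrBr dotcM dotc_unit // mul1r. Qed.

Lemma angleM u x y z : u * u^*%C = 1 -> angle (u * x) (u * y) (u * z) = angle x y z.
Proof. by move=> uu; rewrite /angle !distcM // -!mulrBr dotcM dotc_unit // mul1r. Qed.

(** Between rays of one common length, the angle determines the inner product: by
    Cauchy-Schwarz the cosine is in the range where [acos] is injective. *)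
Lemma angle_inj_dotc x y x' y' z z' (L : R) : 0 < L ->
  distc y x = L -> distc y z = L -> distc y' x' = L -> distc y' z' = L ->
  angle x y z = angle x' y' z' ->
  dotc (x - y) (z - y) = dotc (x' - y') (z' - y').
Proof.
move=> L0; have bound a b c : distc b a = L -> distc b c = L ->
    dotc (a - b) (c - b) / (L * L) \in `[(-1), 1].
  move=> ab bc; rewrite in_itv /= -ler_norml.
  have LL : 0 < L * L by rewrite mulr_gt0.
  rewrite normrM [X in _ * X]gtr0_norm ?invr_gt0 // ler_pdivrMr // mul1r.
  have := Lagrange_identity (a - b) (c - b).
  rewrite -!distc_sqr ab bc => dc.
  rewrite -(@ler_pXn2r _ 2) ?nnegrE ?normr_ge0 ?(ltW LL) //.
  rewrite real_normK ?num_real //.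
  by rewrite exprMn -dc lerDl sqr_ge0.
move=> yx yz yx' yz'; rewrite /angle yx yz yx' yz' => eq_acos.
have LL0 : L * L != 0 by rewrite mulf_neq0 ?gt_eqF.
apply: (mulIf (invr_neq0 LL0)).
by apply: (can_in_inj (@acosK R)) eq_acos; apply: bound.
Qed.

Lemma affine_mapE (A : 'M[R]_2) t z : affine_map A t z =
  ((A ord0 ord0 * Re z + A ord0 ord_max * Im z) +i*
   (A ord_max ord0 * Re z + A ord_max ord_max * Im z)) + t.
Proof.
rewrite /affine_map !mxE !big_ord_recl !big_ord0 !mxE /= !addr0.
by congr (_ +i* _ + _); congr (_ + _ * _); congr (A _ _); apply: val_inj.
Qed.

(** Affine maps preserve ratios of parallel segments. *)
Lemma affine_map_comb (A : 'M[R]_2) t (r : R) x y z w :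
  x - y = r%:C * (z - w) ->
  affine_map A t x - affine_map A t y = r%:C * (affine_map A t z - affine_map A t w).
Proof.
rewrite !affine_mapE; case: t => t1 t2.
case: x y z w => [x x'] [y y'] [z z'] [w w']; simpc => -[Ex Ey].
have -> : x = y + r * (z - w) by rewrite -Ex; ring.
have -> : x' = y' + r * (z' - w') by rewrite -Ey; ring.
by congr (_ +i* _) => /=; ring.
Qed.

(** For a triangle inscribed in the unit circle, twice the signed area is four
    times the product of the sines of half the arcs; its sign
    shows on which side of a chord a point lies. *)
Lemma orient_cis (a b : R) :
  orient 1 (cis (a *+ 2)) (cis (b *+ 2)) = 4 * sin a * sin b * sin (b - a).
Proof.
rewrite /orient /cis /= !subr0 !sin_mulr2n !cos_mulr2n !cos2sin2 sinB; ring.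
Qed.

End Plane.

(** * Cyclic successors *)

Section CyclicIndices.
Variable m : nat.
Hypothesis m_ge3 : (3 <= m)%N.
Implicit Types i j : 'I_m.

Lemma val_ordS i : val (ordS i) = if (i.+1 < m)%N then i.+1 else 0%N.
Proof.
rewrite /=; case: ltnP => [/modn_small //|le_mi].
by have -> : i.+1 = m by [have := ltn_ord i; lia]; rewrite modnn.
Qed.

Lemma ordS_neq i : ordS i != i.
Proof.
rewrite -val_eqE val_ordS; have := ltn_ord i.
by case: (ltnP i.+1 m) => /= ? ?; lia.
Qed.

Lemma ordSS_neq i : ordS (ordS i) != i.
Proof.
rewrite -val_eqE !val_ordS; have := ltn_ord i.
by case: (ltnP i.+1 m) => ? ? /=; case: ifP => ?; lia.
Qed.

Lemma ordSS_notin i : ordS (ordS i) \notin [:: i; ordS i].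
Proof. by rewrite !inE negb_or ordSS_neq ordS_neq. Qed.

Lemma notin_next i : i \notin [:: ordS i; ordS (ordS i)].
Proof. by rewrite !inE negb_or eq_sym ordS_neq eq_sym ordSS_neq. Qed.

Lemma val_iter_ordS i k : val (iter k (@ordS m) i) = ((i + k) %% m)%N.
Proof.
elim: k => [|k IHk]; first by rewrite addn0 modn_small.
by rewrite iterS /= IHk addnS -addn1 modnDml addn1.
Qed.

End CyclicIndices.

(** * Edges of a regular polygon *)

Section RegularPolygons.
Local Open Scope complex_scope.
Local Open Scope ring_scope.
Variables (R : realType) (m : nat).
Implicit Types v w : 'I_m -> R[i].

(** A vertex that coincides with another one lies on the line through an edge. *)
Lemma convex_inj v : convex_polygon v -> injective v.
Proof.
move=> [m_ge3 conv] i j Dv; apply/eqP/negPn/negP => ij.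
have SS := ordSS_notin m_ge3 i.
have [Dj|Sij] := eqVneq j (ordS i).
  by have := conv i _ _ SS SS; rewrite -Dj Dv orient_xxy mul0r ltxx.
have ji : j \notin [:: i; ordS i] by rewrite !inE negb_or eq_sym ij.
by have := conv i _ _ ji ji; rewrite Dv orient_xyx mul0r ltxx.
Qed.

Definition edge v i := v (ordS i) - v i.

Lemma edge_neq0 v i : convex_polygon v -> edge v i != 0.
Proof.
move=> v_conv; rewrite subr_eq0; apply/eqP => /(convex_inj v_conv) /eqP.
by apply/negP/ordS_neq; case: v_conv.
Qed.

(** The quotient of consecutive edges is [(d + i c) / L^2], where L is the edge
    length, [d] the inner product and [c] the cross product of the two edges.
    The distances and angles make [d] constant, Lagrange's identity then makes
    [c^2] constant, and convexity prevents [c] from changing sign. *)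
Lemma regular_edge v : regular_polygon v ->
  exists omega : R[i], forall i, edge v (ordS i) = omega * edge v i.
Proof.
move=> [v_conv v_dist v_angle]; have m_ge3 := v_conv.1.
have i0 : 'I_m := Ordinal (ltn_trans (isT : 0 < 2)%N m_ge3).
pose c i := crossc (edge v i) (edge v (ordS i)).
pose d i := dotc (edge v i) (edge v (ordS i)).
pose L := distc (v i0) (v (ordS i0)).
have edge_sqr i : dotc (edge v i) (edge v i) = L ^+ 2.
  by rewrite -distc_sqr (v_dist i i0).
have L_gt0 : 0 < L.
  rewrite lt_def sqrtr_ge0 andbT -sqrf_eq0 -(edge_sqr i0).
  by rewrite gt_eqF // dotc_gt0 // edge_neq0.
have distC x y : distc x y = distc y x :> R.
  by rewrite /distc -dotcNN opprB.
have d_cst i : d (ordS i) = d i.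
  have dE j : d j = - dotc (v j - v (ordS j)) (v (ordS (ordS j)) - v (ordS j)).
    by rewrite /d /edge -dotcNl opprB.
  rewrite !dE; congr (- _).
  have dist1 j : distc (v (ordS j)) (v j) = L by rewrite distC (v_dist j i0).
  have dist2 j : distc (v j) (v (ordS j)) = L by rewrite (v_dist j i0).
  apply: (angle_inj_dotc L_gt0) => //.
  by have := v_angle (ordS (ordS i)) (ordS i); rewrite !ordSK.
have c_cst i : c (ordS i) = c i.
  have cE j : c j = orient (v j) (v (ordS j)) (v (ordS (ordS j))).
    by rewrite /c orientE.
  (* Vertices i and i+3 are on the same side of the edge from i+1 to i+2. *)
  have cc : 0 < c (ordS i) * c i.
    rewrite !cE (orient_rot (v i)).
    exact: v_conv.2 (ordSS_notin _ _) (notin_next _ _).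
  have c2 j : c j ^+ 2 = L ^+ 2 * L ^+ 2 - d j ^+ 2.
    have := Lagrange_identity (edge v j) (edge v (ordS j)).
    by rewrite !edge_sqr -/(c j) -/(d j); lra.
  have : c (ordS i) ^+ 2 == c i ^+ 2 by rewrite !c2 d_cst.
  rewrite eqf_sqr => /orP[/eqP //|/eqP cN].
  by move: cc; rewrite cN mulNr oppr_gt0 -expr2 ltNge sqr_ge0.
(* The cyclic successor acts transitively on the indices. *)
have iter_cst (f : 'I_m -> R) : (forall i, f (ordS i) = f i) -> forall i, f i = f i0.
  move=> f_cst i; have [k ->] : exists k, i = iter k (@ordS m) i0.
    exists (i + m - i0)%N; apply: val_inj; rewrite val_iter_ordS.
    have -> : (i0 + (i + m - i0) = i + m)%N by have := ltn_ord i0; lia.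
    by rewrite modnDr modn_small.
  by elim: k => //= k; rewrite f_cst.
exists ((d i0 +i* c i0) / (L ^+ 2)%:C) => i.
have eJ : (edge v i)^*%C * edge v i = (L ^+ 2)%:C.
  by rewrite conjc_mulE edge_sqr; congr (_ +i* _); rewrite /crossc; ring.
have e0 : (edge v i)^*%C != 0 by rewrite conjc_eq0 edge_neq0.
have ne0 := edge_neq0 i v_conv.
rewrite -(iter_cst _ d_cst i) -(iter_cst _ c_cst i) /d /c -conjc_mulE -eJ.
apply: (mulfI e0); rewrite invfM; move: (_^*%C) e0 ne0 => y y0.
move: (edge v i) (edge v _) => x z x0.
by field; rewrite x0.
Qed.

(** Going once around the polygon gives [omega^m = 1]. If the order d of
    [omega] were less than m, then the edges from vertex 0 to vertex d would sum
    to zero as a full set of powers of [omega], and two vertices would coincide. *)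
Lemma regular_edge_root v : regular_polygon v ->
  exists2 omega : R[i], m.-primitive_root omega &
    forall i, edge v (ordS i) = omega * edge v i.
Proof.
move=> v_reg; have [v_conv _ _] := v_reg; have m_ge3 := v_conv.1.
have m_gt0 : (0 < m)%N by lia.
have [omega om] := regular_edge v_reg; exists omega => //.
have i0 : 'I_m := Ordinal m_gt0.
pose e := edge v; have e0 := edge_neq0 i0 v_conv.
have eX k : e (iter k (@ordS m) i0) = omega ^+ k * e i0.
  by elim: k => [|k IHk]; rewrite ?mul1r // iterS /e om -/e IHk exprS mulrA.
have iter_m : iter m (@ordS m) i0 = i0.
  by apply: val_inj; rewrite val_iter_ordS modnDr modn_small.
have om_m : omega ^+ m = 1.
  by apply: (mulIf e0); rewrite mul1r -[RHS]/(e i0) -[in RHS]iter_m eX.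
(* Geometric sum of the edges, with the denominator cleared. *)
have vX k : (v (iter k (@ordS m) i0) - v i0) * (omega - 1) = (omega ^+ k - 1) * e i0.
  elim: k => [|k IHk]; first by rewrite expr0 !subrr !mul0r.
  have -> : v (iter k.+1 (@ordS m) i0) =
      e (iter k (@ordS m) i0) + v (iter k (@ordS m) i0).
    by rewrite /e /edge subrK.
  by rewrite -addrA mulrDl IHk eX exprS; ring.
have [d prim_d d_m] := prim_order_exists m_gt0 om_m.
suff Dm : m = d by rewrite [X in X.-primitive_root _]Dm.
have d_gt0 := prim_order_gt0 prim_d.
apply/eqP; rewrite eqn_leq [(d <= m)%N]dvdn_leq // andbT leqNgt; apply/negP => lt_dm.
(* Otherwise three consecutive vertices would be collinear. *)
have om1 : omega - 1 != 0.
  rewrite subr_eq0; apply/eqP => om1.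
  have := v_conv.2 i0 _ _ (ordSS_notin m_ge3 i0) (ordSS_notin m_ge3 i0).
  have -> : v (ordS (ordS i0)) = v (ordS i0) + (v (ordS i0) - v i0).
    by have := om i0; rewrite om1 mul1r /edge => <-; ring.
  rewrite orientE [X in crossc _ X]addrAC subrr add0r.
  by rewrite /crossc [X in _ - X]mulrC subrr mul0r ltxx.
have /eqP := vX d; rewrite prim_expr_order // subrr mul0r mulf_eq0 (negPf om1) orbF.
rewrite subr_eq0 => /eqP /(convex_inj v_conv) /(congr1 val).
rewrite val_iter_ordS => /eqP i0_d.
have : (i0 + d == i0 + 0 %[mod m])%N by rewrite addn0 (modn_small (ltn_ord i0)).
by rewrite eqn_modDl mod0n modn_small // gtn_eqF.
Qed.

End RegularPolygons.

(** * The regular polygon of the m-th roots of unity *)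

Section RootsOfUnityPolygon.
Local Open Scope complex_scope.
Local Open Scope ring_scope.
Variables (R : realType) (m : nat).
Hypothesis m_ge3 : (3 <= m)%N.
Let m_gt0 : (0 < m)%N. Proof. exact: ltn_trans m_ge3. Qed.
Let zm : R[i] := zeta R m.

Definition zeta_polygon (i : 'I_m) : R[i] := zm ^+ i.

Lemma zetaXJ k : zm ^+ k * (zm ^+ k)^*%C = 1.
Proof. by rewrite rmorphXn /= -exprMn zetaJ expr1n. Qed.

(** Used to rotate a triangle of vertices so that its first vertex is 1. *)
Lemma zeta_polygon_shift (i j : 'I_m) :
  zeta_polygon j = zm ^+ i * zm ^+ ((j + m - i) %% m)%N.
Proof.
rewrite (prim_expr_mod (zeta_prim R m_gt0)) -exprD.
have -> : (i + (j + m - i) = m + j)%N by have := ltn_ord i; lia.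
by rewrite exprD prim_expr_order ?mul1r //; apply: zeta_prim.
Qed.

Lemma zeta_polygonS (i : 'I_m) : zeta_polygon (ordS i) = zm ^+ i * zm.
Proof. by rewrite /zeta_polygon /= (prim_expr_mod (zeta_prim R m_gt0)) exprSr. Qed.

(** The half arcs between 1, [zeta_m] and [zeta_m^l] are multiples of [pi / m] by
    numbers strictly between 0 and m, so their sines are positive. *)
Lemma orient_zeta l : (1 < l < m)%N -> 0 < orient 1 zm (zm ^+ l).
Proof.
move=> /andP[l_gt1 lt_lm]; pose t : R := pi / m%:R.
have nn0 : 0 < m%:R :> R by rewrite ltr0n.
have tE k : 2 * pi / m%:R *+ k = (t *+ k) *+ 2 :> R.
  by rewrite /t -[in LHS]mulrA -mulrnAr mulr_natl.
have -> : zm = cis (t *+ 2) by rewrite -[zm]expr1 zetaX tE.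
have -> : cis (t *+ 2) ^+ l = cis ((t *+ l) *+ 2) by rewrite -cisMn -!mulrnA mulnC.
have sin_gt0 k : (0 < k < m)%N -> 0 < sin (t *+ k).
  move=> /andP[k_gt0 lt_km]; apply: sin_gt0_pi.
  rewrite pmulrn_lgt0 // /t divr_gt0 ?pi_gt0 //=.
  by rewrite -[_ *+ k]mulr_natr mulrAC ltr_pdivrMr // ltr_pM2l ?pi_gt0 // ltr_nat.
have -> : cis (t *+ 2) = cis (t *+ 1 *+ 2) by [].
rewrite orient_cis -mulrnBr; last lia.
by rewrite !mulr_gt0 ?ltr0n // sin_gt0 //; lia.
Qed.

Lemma zeta_polygon_convex : convex_polygon zeta_polygon.
Proof.
split=> // i.
have pos j : j \notin [:: i; ordS i] ->
    0 < orient (zeta_polygon i) (zeta_polygon (ordS i)) (zeta_polygon j).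
  move=> j_i; rewrite zeta_polygonS (zeta_polygon_shift i j) -[zeta_polygon i]mulr1.
  rewrite orientM dotc_unit ?zetaXJ // mul1r; apply: orient_zeta.
  move: j_i; rewrite !inE -!val_eqE (val_ordS m_ge3) /=.
  have [lt_im lt_jm] := (ltn_ord i, ltn_ord j).
  have [le_ij|lt_ji] := leqP i j.
    have -> : (j + m - i = (j - i) + m)%N by lia.
    rewrite modnDr modn_small; last lia.
    by case: (ltnP i.+1 m) => ?; lia.
  rewrite modn_small; last lia.
  by case: (ltnP i.+1 m) => ?; lia.
by move=> j k ij ik; rewrite mulr_gt0 // pos.
Qed.

Lemma zeta_polygon_regular : regular_polygon zeta_polygon.
Proof.
split; first exact: zeta_polygon_convex.
  have dist i : distc (zeta_polygon i) (zeta_polygon (ordS i)) = distc 1 zm.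
    by rewrite zeta_polygonS -[zeta_polygon i]mulr1 distcM ?zetaXJ.
  by move=> i j; rewrite !dist.
have ang i : angle (zeta_polygon (ord_pred i)) (zeta_polygon i) (zeta_polygon (ordS i))
    = angle (zm ^+ m.-1) 1 zm.
  rewrite zeta_polygonS -[zeta_polygon i]mulr1.
  have -> : zeta_polygon (ord_pred i) = zm ^+ i * zm ^+ m.-1.
    rewrite /zeta_polygon /= (prim_expr_mod (zeta_prim R m_gt0)) -exprD.
    by congr (_ ^+ _); lia.
  by rewrite angleM ?zetaXJ.
by move=> i j; rewrite !ang.
Qed.

End RootsOfUnityPolygon.

(** * Affinely regular polygons and inclusions of fields *)

Section Implications.
Local Open Scope complex_scope.
Local Open Scope ring_scope.
Variables (R : realType) (m n : nat).
Hypotheses (m_ge3 : (3 <= m)%N) (n_ge3 : (3 <= n)%N).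
Let m_gt0 : (0 < m)%N. Proof. exact: ltn_trans m_ge3. Qed.
Let n_gt0 : (0 < n)%N. Proof. exact: ltn_trans n_ge3. Qed.
Local Notation zm := (zeta R m).
Local Notation zn := (zeta R n).
Local Notation sm := (zm + zm^*%C).

(** The relation [e_(i-1) + e_i + e_(i+1) = (omega^-1 + 1 + omega) e_i] between the
    edges of a regular polygon has a real coefficient, so it survives an affine
    map. *)
Lemma affinely_regular_edges (v : 'I_m -> R[i]) : affinely_regular_polygon v ->
  exists2 omega : R[i], m.-primitive_root omega & forall i,
    v (ordS (ordS (ordS i))) - v i = (1 + (omega + omega^-1)) * edge v (ordS i).
Proof.
move=> [A [t [w [_ w_reg vE]]]].
have [omega prim_om edgeS] := regular_edge_root w_reg.
exists omega => // i.
have om0 := primitive_root_neq0 prim_om.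
have omJ : omega^*%C = omega^-1.
  have [k ->] := prim_rootP (zeta_prim R m_gt0) (prim_expr_order prim_om).
  by rewrite unitJ_inv ?zetaXJ.
set c := 1 + _; have cR : c = (Re c)%:C.
  have : Im c = 0 by rewrite /c -omJ; case: (omega) => a b /=; rewrite subrr addr0.
  by case: (c) => a b /= ->.
rewrite cR /edge !vE; apply: affine_map_comb; rewrite -cR.
have e1 := edgeS i; have e2 := edgeS (ordS i).
have -> : w (ordS (ordS (ordS i))) - w i =
    edge w (ordS (ordS i)) + edge w (ordS i) + edge w i.
  by rewrite /edge; ring.
have -> : edge w i = omega^-1 * edge w (ordS i) by rewrite e1 mulKf.
by rewrite e2 -/(edge w (ordS i)) /c; ring.
Qed.

(** The coefficient [1 + omega + omega^-1] is a ratio of differences of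
    vertices, so it is in [K_n]. Whichever primitive root [omega] is,
    [zeta_m] is one of its powers, so its trace is in [K_n] as well. *)
Lemma trace_of_polygon :
  (exists v : 'I_m -> R[i],
     affinely_regular_polygon v /\ polygon_in (Oring R n) v) ->
  Kfield R n sm.
Proof.
move=> [v [v_aff [v_conv vO]]].
have [Kring KV] := (divring_closedP _).1 (adjoinQ_divring zn).
have vK i : Kfield R n (v i) := adjoinZ_sub_adjoinQ (vO i).
have [omega prim_om vE] := affinely_regular_edges v_aff.
have om0 := primitive_root_neq0 prim_om.
pose i0 := Ordinal m_gt0.
have e0 := edge_neq0 (ordS i0) v_conv.
have om_K : Kfield R n (omega + omega^-1).
  have -> : omega + omega^-1 =
      (v (ordS (ordS (ordS i0))) - v i0) / edge v (ordS i0) - 1.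
    by rewrite vE mulfK // addrAC subrr add0r.
  apply: (subringB Kring); last exact: (subring1 Kring).
  apply: (subringM Kring); last apply: KV; exact: (subringB Kring (vK _) (vK _)).
have [k Dzm] := prim_rootP prim_om (prim_expr_order (zeta_prim R m_gt0)).
by rewrite (unitJ_inv (zetaJ R m)) Dzm; apply: (subring_XDXV Kring).
Qed.

Lemma kfield_sub : Kfield R n sm -> kfield R m `<=` kfield R n.
Proof.
move=> smK; apply: adjoinQ_min; first exact: adjoinQ_divring.
apply: (adjoinQ_real_sub (zetaJ R n) (Im_zeta_neq0 R n_ge3)).
by split=> //; apply: traceJ_real.
Qed.

Lemma oring_sub : Oring R n sm -> oring R m `<=` oring R n.
Proof.
move=> smO; apply: adjoinZ_min; first exact: adjoinZ_subring.
apply: (adjoinZ_real_sub (zetaJ R n) (Im_zeta_neq0 R n_ge3)).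
by split=> //; apply: traceJ_real.
Qed.

Lemma trace_index : Kfield R n sm ->
  m \in [:: 3; 4; 6] \/ (m %| n)%N \/
    exists d : nat, [/\ odd d, (d %| n)%N & m = (2 * d)%N].
Proof. by move=> smK; apply: pm1_kernel_cases => // a; apply: trace_in_Kfield smK. Qed.

(** The real-linear map that fixes 1 and sends [zeta_m] to [zeta_n]. *)
Definition shear_mx : 'M[R]_2 :=
  let q := Im zn / Im zm in let p := (Re zn - Re zm) / Im zm in
  \matrix_(i < 2, j < 2) if i == ord0 then (if j == ord0 then 1 else p)
                         else (if j == ord0 then 0 else q).

Lemma shear_mapE z : affine_map shear_mx 0 z =
  (Re z + (Re zn - Re zm) / Im zm * Im z) +i* (Im zn / Im zm * Im z).
Proof. by rewrite affine_mapE addr0 !mxE /= mul1r mul0r add0r. Qed.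

Lemma shear_det : \det shear_mx = Im zn / Im zm.
Proof.
rewrite -det_tr det_trig; last first.
  by apply/is_trig_mxP => -[[|[|//]] ?] [[|[|//]] ?] //= _; rewrite !mxE.
by rewrite !big_ord_recl big_ord0 !mxE /= mul1r mulr1.
Qed.

Lemma shear_det_neq0 : \det shear_mx != 0.
Proof. by rewrite shear_det mulf_neq0 ?invr_eq0 ?Im_zeta_neq0. Qed.

Lemma shear_orient x y z :
  orient (affine_map shear_mx 0 x) (affine_map shear_mx 0 y)
    (affine_map shear_mx 0 z) = \det shear_mx * orient x y z.
Proof.
rewrite shear_det !shear_mapE /orient.
by case: x y z => [? ?] [? ?] [? ?] /=; ring.
Qed.

Lemma shear_span (a b : R[i]) : Im a = 0 -> Im b = 0 ->
  affine_map shear_mx 0 (a + b * zm) = a + b * zn.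
Proof.
have := Im_zeta_neq0 R m_ge3; rewrite shear_mapE.
case: a b zm zn => [a a'] [b b'] [u u'] [w w'] /= u0 -> ->; simpc.
by congr (_ +i* _); field.
Qed.

(** The powers of [zeta_m] are [a + b zeta_m] with [a] and [b] in [o_m], and the
    image of such a number is [a + b zeta_n]. Convexity survives because the
    product of two orientations is multiplied by the square of the determinant. *)
Lemma polygon_of_oring : oring R n sm ->
  exists v : 'I_m -> R[i], affinely_regular_polygon v /\ polygon_in (Oring R n) v.
Proof.
move=> sm_on; pose f := affine_map shear_mx 0.
exists (fun i => f (zeta_polygon R i)).
split.
  exists shear_mx, 0, (@zeta_polygon R m); split=> //; first exact: shear_det_neq0.
  exact: zeta_polygon_regular.
split.
  have [_ conv] := zeta_polygon_convex R m_ge3; split=> // i j k ij ik.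
  rewrite /f !shear_orient mulrACA -expr2 mulr_gt0 ?conv //.
  by rewrite lt_def sqr_ge0 sqrf_eq0 shear_det_neq0.
move=> i.
have Oring_n := adjoinZ_subring zn.
have sm_On : Oring R n sm.
  move: sm_on; apply: adjoinZ_min => //.
  exact: trace_Oring.
have : quadratic_span zm (oring R m) (zeta_polygon R i).
  have sring := adjoinZ_subring sm.
  apply: (subringX (quadratic_subring (zetaJ R m) sring (@adjoinZ_gen _ _))).
  exists 0, 1; split; last by rewrite add0r mul1r.
    exact: (subring0 sring).
  exact: (subring1 sring).
move=> [a [b [oa ob ->]]].
have o_real x : oring R m x -> Im x = 0.
  by move/adjoinZ_sub_adjoinQ; apply: adjoinQ_real; apply: traceJ_real.
have o_On x : oring R m x -> Oring R n x by apply: adjoinZ_min.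
rewrite /f shear_span; try exact: o_real.
apply: (subringD Oring_n); first exact: o_On.
by apply: (subringM Oring_n); [exact: o_On|exact: adjoinZ_gen].
Qed.

End Implications.

Theorem theorem6 (R : realType) (m n : nat) (hm : (3 <= m)%N) (hn : (3 <= n)%N) :
  [<-> (exists v : 'I_m -> complex R,
          affinely_regular_polygon v /\ polygon_in (Oring R n) v);
       (kfield R m `<=` kfield R n);
       (m \in [:: 3; 4; 6] \/ Kfield R m `<=` Kfield R n);
       (m \in [:: 3; 4; 6] \/ (m %| n)%N \/
          exists d : nat, [/\ odd d, (d %| n)%N & m = (2 * d)%N]);
       (m \in [:: 3; 4; 6] \/ Oring R m `<=` Oring R n);
       (oring R m `<=` oring R n)].
Proof.
have m_gt0 : (0 < m)%N by apply: ltn_trans hm.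
have n_gt0 : (0 < n)%N by apply: ltn_trans hn.
have trace_k : kfield R n `<=` Kfield R n.
  apply: adjoinQ_min; first exact: adjoinQ_divring.
  by apply: adjoinZ_sub_adjoinQ; apply: trace_Oring.
have zeta_On : (m %| n)%N \/ (exists d, [/\ odd d, (d %| n)%N & m = (2 * d)%N]) ->
    Oring R n (zeta R m).
  move=> /(zeta_pow_of_dvd R m_gt0 n_gt0) [e [k ->]].
  have Oring_n := adjoinZ_subring (zeta R n).
  apply: (subringM Oring_n); apply: (subringX Oring_n).
    exact: (subringN Oring_n (subring1 Oring_n)).
  exact: adjoinZ_gen.
tfae.
- by move=> /(trace_of_polygon hm) /(kfield_sub hn).
- move=> k_sub; have : Kfield R n (zeta R m + (zeta R m)^*%C)%R.
    by apply: trace_k; apply: k_sub; exact: adjoinQ_gen.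
  move/(trace_index hm hn) => [|/zeta_On zO]; first by left.
  right; apply: adjoinQ_min; first exact: adjoinQ_divring.
  exact: adjoinZ_sub_adjoinQ.
- move=> [|K_sub]; first by left.
  apply: (trace_index hm hn); apply: K_sub.
  by apply: adjoinZ_sub_adjoinQ; apply: trace_Oring.
- move=> [|/zeta_On zO]; first by left.
  by right; apply: adjoinZ_min => //; apply: adjoinZ_subring.
- move=> [m346|O_sub]; apply: (oring_sub hn).
    by apply: trace_346 => //; apply: adjoinZ_subring.
  by apply: O_sub; apply: trace_Oring.
- move=> o_sub; apply: polygon_of_oring => //.
  by apply: o_sub; exact: adjoinZ_gen.
Qed.
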